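(* Let $0<\eta<\frac12$, $\ell\ge1$ an integer, and let $\mathcal H$ be a class of hypotheses $h:\mathcal X\to\{-1,1\}$ with (finite) VC-dimension $d>1$. Then for all $0<b,p<1$ satisfying \[ p\left(\frac12-\frac b2\right)\le\eta, \] we have \[ \inf_{\hat h_\ell}\ \sup_{\mathcal D\in\mathscr D(\eta)}\ \mathbb E_{\mathcal D^\ell}\big[\Delta(\hat h_\ell,\mathcal D)\big]\ \ge\ bp\,\check{\mathrm{b}}\big(\ell p/(d-1),b\big). \] Furthermore, for $0\le u<1$, \[ \inf_{\hat h_\ell}\ \sup_{\mathcal D\in\mathscr D(\eta)}\ \mathbb P\big[\Delta(\hat h_\ell,\mathcal D)>bpu\big]\ >\ \check{\mathrm{b}}\big(\ell p/(d-1),b\big)-u . \]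
   Context: The infimum over $\hat h_\ell$ is over all passive learners, i.e. (possibly internally randomized) maps from labeled samples $S_\ell=(X_i,Y_i)_{i\in[\ell]}\in(\mathcal X\times\{-1,1\})^\ell$ to hypotheses $\hat h_\ell\in\mathcal H$. Expectation and probability are over $S_\ell\sim\mathcal D^\ell$ and the learner's randomness. $\mathrm{err}(h,\mathcal D)=\mathbb P_{(X,Y)\sim\mathcal D}[h(X)\ne Y]$. The excess risk is $\Delta(\hat h_\ell,\mathcal D):=\mathrm{err}(\hat h_\ell,\mathcal D)-\inf_{h\in\mathcal H}\mathrm{err}(h,\mathcal D)$. $\mathscr D(\eta)$ is the collection of all distributions $\mathcal D$ over $\mathcal X\times\{-1,1\}$ with $\inf_{h\in\mathcal H}\mathrm{err}(h,\mathcal D)\le\eta$. For $b\in[-1,1]$, $\mathrm R_b$ is the distribution on $\{-1,1\}$ giving mass $\frac12+\frac b2$ to $1$ and $\frac12-\frac b2$ to $-1$; $\mathrm R_b^k$ is the $k$-fold product distribution on $\{-1,1\}^k$. For integers $k\ge0$ and $b\in[0,1]$, \[ \mathrm{bayes}(k,b):=\tfrac12\Big(1-\tfrac12\big\|\mathrm R_b^k-\mathrm R_{-b}^k\big\|_1\Big), \] where $\frac12\|\cdot\|_1$ is the total variation norm (so $\mathrm{bayes}(0,b)=\frac12$). For each fixed $b\in[0,1]$, $\check{\mathrm b}(\cdot,b)$ is the largest convex function on $[0,\infty)$ that is at most $\mathrm{bayes}(k,b)$ at every $k\in\{0,1,2,\dots\}$ (the largest convex minorant of $\mathrm{bayes}(\cdot,b)$).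 *)

(* Defs.v *)
From HB Require Import structures.
From mathcomp Require Import all_boot all_order all_algebra.
From mathcomp Require Import all_classical all_reals all_analysis.
From mathcomp Require Import lra.
Import Order.TTheory GRing.Theory Num.Theory.
Import numFieldNormedType.Exports.

Set Implicit Arguments.
Unset Strict Implicit.
Unset Printing Implicit Defensive.

Local Open Scope classical_set_scope.
Local Open Scope ring_scope.

(* Labels {-1, 1} are encoded by bool: true is 1 and false is -1. *)

Section vc_dimension.
Context {X : Type}.

(* A hypothesis is identified with the set of points that it labels 1. *)
Definition shatters (H : set (X -> bool)) (A : set X) :=
  forall B : set X, B `<=` A ->
    exists2 h, H h & A `&` [set x | h x = true] = B.

Definition VC_dim (H : set (X -> bool)) (d : nat) :=
  (exists2 A : set X, (A #= `I_d)%card & shatters H A) /\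
  (forall (n : nat) (A : set X), (A #= `I_n)%card -> shatters H A -> (n <= d)%N).

End vc_dimension.

Section iid.
Context {R : realType} d (T : measurableType d).

Let tcons n (z : T * n.-tuple T) : n.+1.-tuple T := [tuple of z.1 :: z.2].

Let measurable_tcons n : measurable_fun [set: T * n.-tuple T] (@tcons n).
Proof. exact: measurable_cons. Qed.

HB.instance Definition _ n :=
  isMeasurableFun.Build _ _ _ _ (@tcons n) (@measurable_tcons n).

Fixpoint iid (P : probability T R) (n : nat) : probability (n.-tuple T) R :=
  if n is m.+1 then distribution (P \x iid P m)%E (@tcons m)
  else dirac [tuple].

Lemma iidE (P : probability T R) n (A : 'I_n -> set T) :
  (forall i, measurable (A i)) ->
  iid P n [set t | forall i, A i (tnth t i)] = (\prod_(i < n) P (A i))%E.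
Proof.
elim: n A => [|n IH] A mA /=.
  by rewrite big_ord0 diracE mem_set// => -[].
rewrite big_ord_recl -IH; last by move=> i; exact: mA.
rewrite /distribution/= /pushforward/= -product_measure1E//; last first.
  rewrite (_ : [set _ | _] = \bigcap_(i : 'I_n)
      ((@tnth n T ^~ i) @^-1` A (lift ord0 i))); last first.
    by apply/seteqP; split=> [t h i _|t h i]; [exact: h|exact: (h i)].
  apply: fin_bigcap_measurable => // i _.
  by rewrite -[X in measurable X]setTI; exact: measurable_tnth.
congr (_ _); apply/seteqP; split=> -[x t] /=.
- by move=> h; split=> [|i]; [exact: (h ord0)|rewrite -(tnthS x); exact: h].
- by move=> [h0 h] i; case: (unliftP ord0 i) => [j|] ->; rewrite ?tnthS.
Qed.

End iid.

Section agnostic_learning.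
Context {R : realType} {dX : measure_display} {X : measurableType dX}.
Implicit Types (H : set (X -> bool)) (h : X -> bool)
  (D : probability (X * bool)%type R).

Definition err h D : R := fine (D [set z | h z.1 != z.2]).

Definition min_err H D : R := inf [set err h D | h in H].

Definition excess H h D : R := err h D - min_err H D.

Definition agnostic_class H (eta : R) : set (probability (X * bool)%type R) :=
  [set D | min_err H D <= eta].

(* A passive learner: the output may depend on the labeled sample and on an
   independent internal seed, drawn from an arbitrary probability space. The
   measurability condition is what is needed for the expectation and the
   deviation probabilities of the risk to be defined. *)
Record learner H (l : nat) := Learner {
  seed_disp : measure_display ;
  seed : measurableType seed_disp ;
  seed_prob : probability seed R ;
  output :> l.-tuple (X * bool)%type * seed -> X -> bool ;
  output_in : forall z, H (output z) ;
  measurable_output : forall D, measurable_fun setT (fun z => err (output z) D)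
}.

Arguments seed_prob {H l} _.

(* Joint law of the sample S ~ D^l and the seed of the learner. *)
Definition run_law H l (A : learner H l) D :
    probability (l.-tuple (X * bool)%type * seed A)%type R :=
  (iid D l \x seed_prob A)%E.
Arguments run_law {H l} A D.

Definition expected_excess H l (A : learner H l) D : \bar R :=
  'E_(run_law A D)[fun z => excess H (A z) D].

Definition excess_tail H l (A : learner H l) (t : R) D : \bar R :=
  run_law A D [set z | excess H (A z) D > t].

Definition minimax_expected H l (eta : R) : \bar R :=
  ereal_inf [set v | exists A : learner H l,
    v = ereal_sup [set expected_excess A D | D in agnostic_class H eta]].

Definition minimax_tail H l (eta t : R) : \bar R :=
  ereal_inf [set v | exists A : learner H l,
    v = ereal_sup [set excess_tail A t D | D in agnostic_class H eta]].

End agnostic_learning.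
Arguments learner R {dX X} H l.
Arguments seed_prob {R dX X H l} _.
Arguments run_law {R dX X H l} A D.

Section bayes.
Context {R : realType}.
Implicit Types (b x : R) (k : nat).

Definition biased_pmf b (y : bool) : R := if y then 2^-1 + b / 2 else 2^-1 - b / 2.

Definition biased_pow_pmf k b (y : k.-tuple bool) : R :=
  \prod_(i < k) biased_pmf b (tnth y i).

Definition bayes k b : R :=
  2^-1 * (1 - 2^-1 *
    \sum_(y : k.-tuple bool) `|biased_pow_pmf b y - biased_pow_pmf (- b) y|).

Definition bayes_convex_minorant b (f : R -> R) :=
  convex_function (`[0, +oo[%classic : set R) f /\
  (forall k, f k%:R <= bayes k b).

(* The pointwise supremum of the convex minorants is itself a convex minorant,
   hence the largest one on [0, +oo[ (bayes_checkP). *)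
Definition bayes_check x b : R := sup [set f x | f in bayes_convex_minorant b].

Lemma sum_biased_pow_pmf k b : \sum_(y : k.-tuple bool) biased_pow_pmf b y = 1.
Proof.
rewrite (reindex_onto (fun g : {ffun 'I_k -> bool} => [tuple g i | i < k])
    (fun y => [ffun i => tnth y i])) /=; last first.
  by move=> y _; apply: eq_from_tnth => i; rewrite tnth_mktuple ffunE.
rewrite (eq_big xpredT (fun g : {ffun 'I_k -> bool} =>
    \prod_(i < k) biased_pmf b (g i))); first last.
- by move=> g _; apply: eq_bigr => i _; rewrite tnth_mktuple.
- by move=> g; apply/eqP/ffunP => i; rewrite ffunE tnth_mktuple.
rewrite -(bigA_distr_bigA (fun _ : 'I_k => biased_pmf b)) big1// => i _.
by rewrite big_bool /=; lra.
Qed.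

Lemma bayes_le1 k b : bayes k b <= 1.
Proof.
rewrite /bayes; set s := \sum_(_ | _) _.
have s0 : 0 <= s by exact: sumr_ge0.
lra.
Qed.

Lemma bayes_ge0 k b : -1 <= b <= 1 -> 0 <= bayes k b.
Proof.
move=> /andP[b1 b2]; rewrite /bayes; set s := \sum_(_ | _) _.
have pmf0 c : -1 <= c <= 1 -> forall y : k.-tuple bool, 0 <= biased_pow_pmf c y.
  move=> /andP[c1 c2] y; apply: prodr_ge0 => i _.
  by rewrite /biased_pmf; case: ifP => _; lra.
suff : s <= 2 by move=> s2; lra.
have -> : 2 = \sum_(y : k.-tuple bool) (biased_pow_pmf b y + biased_pow_pmf (- b) y).
  by rewrite big_split/= !sum_biased_pow_pmf.
apply: ler_sum => y _; rewrite (le_trans (ler_normB _ _))//.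
by rewrite !ger0_norm ?pmf0//; lra.
Qed.

Lemma bayes_convex_minorant_le1 b f x :
  bayes_convex_minorant b f -> 0 <= x -> f x <= 1.
Proof.
move=> [cf fb] x0; have f1 k : f k%:R <= 1 := le_trans (fb k) (bayes_le1 k b).
pose N : R := (Num.truncn x).+1%:R.
have xN : x <= N by apply: ltW; rewrite truncnS_gt.
have N0 : 0 < N by rewrite ltr0n.
have t0 : 0 <= x / N by rewrite divr_ge0// ltW.
have t1 : x / N <= 1 by rewrite ler_pdivrMr// mul1r.
have := cf (Itv01 t0 t1) N 0; rewrite !inE/= !in_itv/= lexx (ltW N0).
move=> /(_ isT isT); rewrite convRE.
rewrite [X in f X](_ : _ = x / N * N + (1 - x / N) * 0)//.
rewrite mulr0 addr0 divfK ?gt_eqF//=.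
move=> /le_trans; apply; rewrite -[leRHS](subrKC (x / N)).
rewrite lerD// ler_piMr ?subr_ge0//; first exact: (f1 _.+1).
exact: (f1 0%N).
Qed.

Lemma bayes_checkP b : -1 <= b <= 1 ->
  bayes_convex_minorant b (bayes_check ^~ b) /\
  (forall f, bayes_convex_minorant b f ->
     forall x, 0 <= x -> f x <= bayes_check x b).
Proof.
move=> b1.
have b0 : bayes_convex_minorant b (cst 0).
  split=> [t x y _ _|k]; last exact: bayes_ge0.
  by rewrite convRE /= !mulr0 addr0.
have ubP f x : bayes_convex_minorant b f -> 0 <= x -> f x <= bayes_check x b.
  move=> bf x0; apply: ub_le_sup; last by exists f.
  by exists 1 => _ [g bg <-]; exact: bayes_convex_minorant_le1 bg x0.
have lubP x c : (forall f, bayes_convex_minorant b f -> f x <= c) ->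
    bayes_check x b <= c.
  by move=> h; apply: ge_sup => [|_ [f /h ? <-]//]; exists 0; exists (cst 0).
split=> [|f bf x x0]; last exact: ubP.
split=> [t x y|k]; last by apply: lubP => f [].
rewrite !inE/= !in_itv/= !andbT => x0 y0; apply: lubP => f bf.
apply: (le_trans (bf.1 t x y _ _)); rewrite ?inE/= ?in_itv/= ?andbT//.
rewrite !convRE; apply: lerD; apply: ler_wpM2l; rewrite ?subr_ge0//.
- exact: ubP.
- exact: ubP.
Qed.

End bayes.

(* Main.v *)
(* Put mass 1 - p on one point of a shattered set and p / (d - 1) on each of the
   n = d - 1 others, whose labels have bias b towards unknown signs s.  Up to
   the factor b p, the excess risk is at least the fraction of signs that the
   learner gets wrong.  For uniform s, and given that a point is sampled k times,
   guessing its sign is testing R_b^k against R_{-b}^k, so the error probability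
   is at least bayes(k, b); k is binomial with mean l p / (d - 1), and Jensen's
   inequality for the convex minorant gives the bound in expectation.
   For the tail, E Z <= u + (1 - u) P(Z > u) where Z in [0, 1] is the fraction of
   wrong signs.  This is strict, uniformly over learners, when u > 0, because
   P(Z = 1) is bounded below: the sample may well miss all n points.  When u = 0,
   the same family with a bias tending to 0 gives the bound 1/2, which exceeds
   the convex minorant at any positive point. *)
Require Import Defs.
From HB Require Import structures.
From mathcomp Require Import all_boot all_order all_algebra.
From mathcomp Require Import all_classical all_reals all_analysis measurable_realfun.
From mathcomp Require Import ring lra.
Import Order.TTheory GRing.Theory Num.Theory.
Import numFieldNormedType.Exports.
Local Open Scope classical_set_scope.
Local Open Scope ring_scope.

Set Implicit Arguments.
Unset Strict Implicit.
Unset Printing Implicit Defensive.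

(** * Binomial averages and Jensen's inequality *)

Lemma convex_on_nonneg {R : realType} (f : R -> R) (t x y : R) :
  convex_function (`[0, +oo[%classic : set R) f ->
  0 <= t <= 1 -> 0 <= x -> 0 <= y ->
  f (t * x + (1 - t) * y) <= t * f x + (1 - t) * f y.
Proof.
move=> cf /andP[t0 t1] x0 y0; have := cf (Itv01 t0 t1) x y.
by rewrite !inE/= !in_itv/= !andbT !convRE; exact.
Qed.

Section binomial_mean.
Context {R : realType}.
Implicit Types (q c : R) (g f : nat -> R) (l : nat).

(** Expectation of [g k] for [k] binomial with parameters [l] and [q], by conditioning on the first
    trial; this matches a sample revealed one observation at a time. *)
Fixpoint binom_mean q l g : R :=
  if l is m.+1 then (1 - q) * binom_mean q m g
                    + q * binom_mean q m (fun k => g k.+1)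
  else g 0%N.

Lemma binom_mean_le q l g f : 0 <= q <= 1 -> (forall k, (k <= l)%N -> g k <= f k) ->
  binom_mean q l g <= binom_mean q l f.
Proof.
move=> /andP[q0 q1]; elim: l g f => [|l IH] g f gf /=; first exact: gf.
rewrite lerD// ler_wpM2l ?subr_ge0//; apply: IH => k kl; apply: gf => //.
exact: leqW.
Qed.

Lemma binom_meanD q l g f :
  binom_mean q l (g \+ f) = binom_mean q l g + binom_mean q l f.
Proof. by elim: l g f => //= l IH g f; rewrite [X in _ * X + _]IH IH; ring. Qed.

Lemma binom_meanZ q l c g :
  binom_mean q l (c \*o g) = c * binom_mean q l g.
Proof. by elim: l g => //= l IH g; rewrite [X in _ * X + _]IH IH; ring. Qed.

Lemma binom_mean_cst q l c : binom_mean q l (fun=> c) = c.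
Proof. by elim: l => //= l ->; ring. Qed.

(** The starting point [x] is free for the induction on [l]: a first success moves it to [x + 1],
    and convexity is applied between the two outcomes. *)
Lemma binom_mean_jensen q l (f : R -> R) (x : R) : 0 <= q <= 1 -> 0 <= x ->
  convex_function (`[0, +oo[%classic : set R) f ->
  f (x + l%:R * q) <= binom_mean q l (fun k => f (x + k%:R)).
Proof.
move=> /[dup] q01 /andP[q0 q1] + cf; elim: l x => [|l IH] x x0 /=; first by rewrite mul0r.
have lq0 : 0 <= l%:R * q by exact: mulr_ge0.
have /le_trans : f (x + l.+1%:R * q) <=
    q * f (x + 1 + l%:R * q) + (1 - q) * f (x + l%:R * q).
  rewrite (_ : x + l.+1%:R * q = q * (x + 1 + l%:R * q) + (1 - q) * (x + l%:R * q)).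
    by apply: convex_on_nonneg; rewrite ?addr_ge0.
  by rewrite -natr1 /=; ring.
apply; rewrite addrC lerD// ler_wpM2l ?subr_ge0//; first exact: IH.
apply: le_trans (IH _ _) _; first by rewrite addr_ge0.
by apply: binom_mean_le => // k _; rewrite -addrA -nat1r.
Qed.

End binomial_mean.

(** * Bayes risk of testing opposite biases *)

Section testing_risk.
Context {R : realType}.
Implicit Types (a b c q : R) (k l : nat).

(* Bayes risk of testing R_b^k (prior weight a) against R_{-b}^k (prior
   weight c); the weights are updated one observation at a time. *)
Fixpoint testing_risk b k a c : R :=
  if k is m.+1 then
    \sum_(y : bool) testing_risk b m (a * biased_pmf b y) (c * biased_pmf (- b) y)
  else Num.min a c.

Lemma biased_pmf_ge0 b y : -1 <= b <= 1 -> 0 <= biased_pmf b y.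
Proof. by move=> /andP[? ?]; rewrite /biased_pmf; case: y; lra. Qed.

Lemma sum_biased_pmf b : \sum_(y : bool) biased_pmf b y = 1.
Proof. by rewrite big_bool /=; lra. Qed.

Lemma sum_tuple_cons (V : nmodType) (T : finType) k (F : k.+1.-tuple T -> V) :
  \sum_t F t = \sum_y \sum_(t : k.-tuple T) F [tuple of y :: t].
Proof.
rewrite pair_big /= (reindex (fun z : T * k.-tuple T => [tuple of z.1 :: z.2]))//=.
exists (fun t => (thead t, [tuple of behead t])) => [[y t]|t] _ /=.
  by congr pair; exact/val_inj.
by rewrite -tuple_eta.
Qed.

Lemma biased_pow_pmf_cons b k y (t : k.-tuple bool) :
  biased_pow_pmf b [tuple of y :: t] = biased_pmf b y * biased_pow_pmf b t.
Proof.
rewrite /biased_pow_pmf big_ord_recl tnth0; congr (_ * _).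
by apply: eq_bigr => i _; rewrite tnthS.
Qed.

Lemma testing_riskE b k a c : testing_risk b k a c =
  \sum_(y : k.-tuple bool) Num.min (a * biased_pow_pmf b y) (c * biased_pow_pmf (- b) y).
Proof.
elim: k a c => [|k IH] a c /=.
  rewrite (big_pred1 [tuple]); last by move=> t; rewrite /= [t]tuple0; exact/esym/eqP.
  by rewrite /biased_pow_pmf !big_ord0 !mulr1.
rewrite sum_tuple_cons; apply: eq_bigr => y _; rewrite IH.
by apply: eq_bigr => t _; rewrite !biased_pow_pmf_cons !mulrA.
Qed.

(** Rests on min(u, v) = (u + v - |u - v|) / 2; the factor 2 comes from weights 1 and 1 in place of
    1/2 and 1/2. *)
Lemma testing_risk_bayes b k : testing_risk b k 1 1 = 2 * bayes k b.
Proof.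
rewrite testing_riskE /bayes mulrA divff ?pnatr_eq0// mul1r.
transitivity (\sum_(y : k.-tuple bool) (2^-1 * (biased_pow_pmf b y
    + biased_pow_pmf (- b) y - `|biased_pow_pmf b y - biased_pow_pmf (- b) y|))).
  by apply: eq_bigr => y _; rewrite !mul1r minr_absE mulrC.
rewrite -mulr_sumr !big_split/= !sum_biased_pow_pmf sumrN; lra.
Qed.

Lemma testing_riskZ b k a c q : 0 <= q ->
  testing_risk b k (q * a) (q * c) = q * testing_risk b k a c.
Proof.
move=> q0; rewrite !testing_riskE mulr_sumr; apply: eq_bigr => y _.
by rewrite -!mulrA -minr_pMr.
Qed.

(** Either label multiplies both weights by at least (1 - b) / 2, and there are two labels, so each
    observation keeps a factor 1 - b. *)
Lemma testing_risk_ge b k a c : 0 <= b <= 1 -> 0 <= a -> 0 <= c ->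
  (1 - b) ^+ k * Num.min a c <= testing_risk b k a c.
Proof.
move=> /andP[b0 b1]; elim: k a c => [|k IH] a c a0 c0 /=; first by rewrite mul1r.
have ub y : (1 - b) ^+ k * ((1 - b) / 2 * Num.min a c) <=
    testing_risk b k (a * biased_pmf b y) (c * biased_pmf (- b) y).
  apply: (le_trans _ (IH _ _ _ _)); try by rewrite mulr_ge0 ?biased_pmf_ge0//; lra.
  rewrite ler_wpM2l ?exprn_ge0 ?subr_ge0// le_min.
  have [m1 m2] : Num.min a c <= a /\ Num.min a c <= c.
    by rewrite !ge_min !lexx orbT.
  have m0 : 0 <= Num.min a c by rewrite le_min a0.
  by apply/andP; split; rewrite /biased_pmf; case: y; nra.
rewrite big_bool; apply: le_trans _ (lerD (ub true) (ub false)).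
by rewrite exprS; lra.
Qed.

Lemma bayes_ge_expr b k : 0 <= b <= 1 -> (1 - b) ^+ k / 2 <= bayes k b.
Proof.
move=> b01; have := @testing_risk_ge b k 1 1 b01 ler01 ler01.
by rewrite testing_risk_bayes minxx; lra.
Qed.

Lemma bayes_le_half b k : bayes k b <= 2^-1.
Proof.
rewrite /bayes; set s := \sum_(_ | _) _.
by have s0 : 0 <= s by [exact: sumr_ge0]; lra.
Qed.

Lemma bayes_lt_half b k : 0 < b <= 1 -> (0 < k)%N -> bayes k b < 2^-1.
Proof.
move=> /andP[b0 b1] k0; rewrite /bayes; set s := \sum_(_ | _) _.
suff s0 : 0 < s by lra.
(* A single tuple with different masses under the two biases suffices: the one whose labels are all
   [true]. *)
rewrite /s (bigD1 [tuple true | i < k])//= ltr_pwDl ?sumr_ge0// normr_gt0 subr_eq0 gt_eqF//.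
rewrite /biased_pow_pmf.
under eq_bigr do rewrite tnth_mktuple /=.
under [ltRHS]eq_bigr do rewrite tnth_mktuple /=.
rewrite !prodr_const card_ord ltrXn2r -?lt0n//; lra.
Qed.

(** The point [x] lies between 0, where the minorant is at most 1/2, and a positive integer [N],
    where it is below 1/2; convexity carries strictness over to [x > 0]. *)
Lemma bayes_check_lt_half b x : 0 < b <= 1 -> 0 < x -> bayes_check x b < 2^-1.
Proof.
move=> /andP[b0 b1] x0.
have [|[cv le_bayes] _] := @bayes_checkP R b; first by apply/andP; split; lra.
pose N : R := (Num.truncn x).+1%:R.
have xN : x <= N by apply: ltW; rewrite truncnS_gt.
have N0 : 0 < N by rewrite ltr0n.
have t0 : 0 < x / N by exact: divr_gt0.
have t1 : x / N <= 1 by rewrite ler_pdivrMr// mul1r.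
have t01 : 0 <= x / N <= 1 by rewrite (ltW t0).
have := convex_on_nonneg cv t01 (ltW N0) (lexx 0).
rewrite mulr0 addr0 divfK ?gt_eqF//.
have h1 : bayes_check N b < 2^-1.
  by apply: le_lt_trans (le_bayes _) _; rewrite bayes_lt_half ?b0.
have h0 : bayes_check 0 b <= 2^-1 by exact: le_trans (le_bayes 0%N) (bayes_le_half _ _).
by move=> /le_lt_trans; apply; set t := x / N in t0 t1 *; nra.
Qed.

Lemma bayes_check_ge0 b x : -1 <= b <= 1 -> 0 <= x -> 0 <= bayes_check x b.
Proof.
move=> b1 x0; have [_ /(_ (cst 0))] := @bayes_checkP R b b1; apply => //.
by split=> [t y z _ _|k]; [rewrite convRE /= !mulr0 addr0|exact: bayes_ge0].
Qed.

Lemma bayes_check_le_binom_mean b q l : -1 <= b <= 1 -> 0 <= q <= 1 ->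
  bayes_check (l%:R * q) b <= binom_mean q l (bayes ^~ b).
Proof.
move=> b1 q01; have [[cv le_bayes] _] := @bayes_checkP R b b1.
have := @binom_mean_jensen R q l _ 0 q01 (lexx 0) cv; rewrite add0r => /le_trans.
by apply; apply: binom_mean_le => // k _; rewrite add0r.
Qed.

End testing_risk.

(** * Sample expectations as finite sums *)

Section iid_mean.
Context {R : realType} {J : finType} {T : Type} (pt : J -> T).
Implicit Types (w : J -> R) (l : nat).

(** Expectation of [g] over [l] independent draws of an index [z] of weight [w z], each observed as
    [pt z]. *)
Fixpoint iid_mean w l : (l.-tuple T -> R) -> R :=
  if l is m.+1 then
    fun g => \sum_z w z * iid_mean w (fun t : m.-tuple T => g [tuple of pt z :: t])
  else fun g => g [tuple].

Lemma iid_mean_ge0 w l (g : l.-tuple T -> R) : (forall z, 0 <= w z) ->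
  (forall t, 0 <= g t) -> 0 <= iid_mean w g.
Proof.
move=> w0; elim: l g => [|l IH] g g0 /=; first exact: g0.
by apply: sumr_ge0 => z _; rewrite mulr_ge0// IH.
Qed.

Lemma iid_mean_ge_nseq w l (g : l.-tuple T -> R) z : (forall z, 0 <= w z) ->
  (forall t, 0 <= g t) -> w z ^+ l * g [tuple of nseq l (pt z)] <= iid_mean w g.
Proof.
move=> w0; elim: l g => [|l IH] g g0 /=.
  by rewrite mul1r le_eqVlt; apply/orP; left; apply/eqP; congr g; exact: val_inj.
rewrite (bigD1 z)//= ler_wpDr//.
  by apply: sumr_ge0 => z' _; rewrite mulr_ge0// iid_mean_ge0.
rewrite exprS -mulrA ler_wpM2l//; apply: le_trans (IH _ _) => //.
rewrite ler_wpM2l ?exprn_ge0// le_eqVlt; apply/orP; left; apply/eqP.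
by congr g; exact: val_inj.
Qed.

End iid_mean.

Lemma divr_nat_itv01 {R : realFieldType} (n : nat) (p : R) :
  0 <= p <= 1 -> 0 <= p / n%:R <= 1.
Proof.
case: n => [|n] /andP[p0 p1]; first by rewrite invr0 mulr0 lexx ler01.
rewrite divr_ge0//= ler_pdivrMr ?ltr0n// mul1r (le_trans p1)//.
by rewrite ler1n.
Qed.

(** * The hard family indexed by sign vectors *)

Section hard_family.
Context {R : realType} (n : nat) (b p : R).
Hypotheses (b_gt0 : 0 < b) (b_lt1 : b < 1) (p_gt0 : 0 < p) (p_lt1 : p < 1).
Hypothesis n_gt0 : (0 < n)%N.
Implicit Types (s : {ffun 'I_n -> bool}) (i : 'I_n).

(* Each of the points 1, ..., n has mass p / n and a label of bias b towards
   s i; the remaining mass 1 - p is on point 0, always labelled 1. *)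
Definition hard_pmf s (z : 'I_n.+1 * bool) : R :=
  if unlift ord0 z.1 is Some i
  then p / n%:R * biased_pmf (if s i then b else - b) z.2
  else (1 - p) * z.2%:R.

Lemma hard_pmf_ge0 s z : 0 <= hard_pmf s z.
Proof.
rewrite /hard_pmf; case: unlift => [i|]; last by rewrite mulr_ge0// subr_ge0 ltW.
rewrite mulr_ge0 ?divr_ge0 ?(ltW p_gt0)//.
by apply: biased_pmf_ge0; apply/andP; move: b_gt0 b_lt1 => ? ?; case: ifP => _; split; lra.
Qed.

Lemma sum_hard_pmf_mul s (F : 'I_n.+1 -> bool -> R) :
  \sum_z hard_pmf s z * F z.1 z.2 = (1 - p) * F ord0 true + p / n%:R *
    \sum_i \sum_y biased_pmf (if s i then b else - b) y * F (lift ord0 i) y.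
Proof.
rewrite -(pair_bigA _ (fun j y => hard_pmf s (j, y) * F j y))/= big_ord_recl.
congr (_ + _); first by rewrite big_bool /hard_pmf /= unlift_none /=; ring.
rewrite mulr_sumr; apply: eq_bigr => i _; rewrite mulr_sumr.
by apply: eq_bigr => y _; rewrite /hard_pmf /= liftK mulrA.
Qed.

Let n_neq0 : n%:R != 0 :> R. Proof. by rewrite pnatr_eq0 -lt0n. Qed.

Let q01 : 0 <= p / n%:R <= 1.
Proof. by rewrite divr_nat_itv01// (ltW p_gt0) (ltW p_lt1). Qed.

Lemma sum_hard_pmf s : \sum_z hard_pmf s z = 1.
Proof.
under eq_bigr do rewrite -[hard_pmf _ _]mulr1.
rewrite (sum_hard_pmf_mul s (fun _ _ => 1)) [X in _ + _ * X](eq_bigr (fun=> 1)).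
  by rewrite sumr_const card_ord divfK// mulr1 subrK.
by move=> i _; rewrite -mulr_suml sum_biased_pmf mulr1.
Qed.

(** Here [g0] and [g1] are the probabilities of answering wrongly at [i] under [s] and [s'], and
    [a], [c] are running likelihoods. A draw away from [i] scales both likelihoods equally; a draw
    at [i], of probability p / n, advances the test by one observation. Hence the binomial
    average. *)
Lemma le_cam_hard_family T (pt : 'I_n.+1 * bool -> T) s s' i l
    (g0 g1 : l.-tuple T -> R) (a c : R) :
  s i -> ~~ s' i -> (forall j, j != i -> s j = s' j) ->
  (forall t, 0 <= g0 t) -> (forall t, 0 <= g1 t) -> (forall t, g0 t + g1 t = 1) ->
  0 <= a -> 0 <= c ->
  binom_mean (p / n%:R) l (fun k => testing_risk b k a c) <=
  a * iid_mean pt (hard_pmf s) g0 + c * iid_mean pt (hard_pmf s') g1.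
Proof.
move=> si s'i ss'; elim: l g0 g1 a c => [|l IH] g0 g1 a c g0_ge0 g1_ge0 g01 a0 c0 /=.
  have := g01 [tuple]; have := g0_ge0 [tuple]; have := g1_ge0 [tuple].
  set x := g0 _; set y := g1 _ => y0 x0 xy.
  have [m1 m2] : Num.min a c <= a /\ Num.min a c <= c by rewrite !ge_min !lexx orbT.
  by set m := Num.min a c in m1 m2 *; nra.
set q := p / n%:R; set bm := binom_mean q l.
(* The induction hypothesis after a first draw [z], with both weights updated by its likelihoods. *)
pose Phi z := bm (fun k => testing_risk b k (a * hard_pmf s z) (c * hard_pmf s' z)).
apply: (@le_trans _ _ (\sum_z Phi z)); last first.
  rewrite !mulr_sumr -big_split /=; apply: ler_sum => z _; rewrite !mulrA.
  by apply: IH => // ; rewrite mulr_ge0// hard_pmf_ge0.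
have PhiZ z : hard_pmf s z = hard_pmf s' z ->
    Phi z = hard_pmf s z * bm (fun k => testing_risk b k a c).
  rewrite /Phi => <-; rewrite -binom_meanZ; congr (bm _); apply/funext => k /=.
  by rewrite ![_ * hard_pmf s z]mulrC testing_riskZ// hard_pmf_ge0.
have Phi_i y : Phi (lift ord0 i, y) = q * bm (fun k =>
    testing_risk b k (a * biased_pmf b y) (c * biased_pmf (- b) y)).
  rewrite /Phi -binom_meanZ; congr (bm _); apply/funext => k /=.
  rewrite /hard_pmf /= liftK si (negbTE s'i) -/q -testing_riskZ; last by case/andP: q01.
  by congr testing_risk; ring.
have Phi_ord0 : \sum_y Phi (ord0, y) = (1 - p) * bm (fun k => testing_risk b k a c).
  by rewrite big_bool !PhiZ /hard_pmf /= unlift_none//=; ring.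
have Phi_j j : j != i ->
    \sum_y Phi (lift ord0 j, y) = q * bm (fun k => testing_risk b k a c).
  move=> ji; rewrite (eq_bigr (fun y => hard_pmf s (lift ord0 j, y) *
      bm (fun k => testing_risk b k a c))).
    rewrite -mulr_suml /hard_pmf /= liftK -mulr_sumr sum_biased_pmf mulr1//.
  by move=> y _; rewrite PhiZ// /hard_pmf /= liftK ss'.
rewrite -(pair_bigA _ (fun j y => Phi (j, y)))/= big_ord_recl Phi_ord0.
rewrite (bigD1 i)//= (eq_bigr _ Phi_j).
(* The n - 1 points other than [i] carry total mass p - q, since n q = p. *)
have -> : \sum_(j < n | j != i) q * bm (fun k => testing_risk b k a c) =
    (p - q) * bm (fun k => testing_risk b k a c).
  set C := q * bm _; apply: (addrI C).
  have <- : C *+ n = C + \sum_(j < n | j != i) C.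
    by rewrite -{1}(card_ord n) -sumr_const (bigD1 i).
  rewrite -mulr_natl /C mulrA [n%:R * q](_ : _ = p); last by rewrite mulrC divfK.
  by ring.
under eq_bigr do rewrite Phi_i.
rewrite -mulr_sumr big_bool /bm /= -binom_meanD.
rewrite (_ : _ \+ _ = fun k => testing_risk b k.+1 a c); last first.
  by apply/funext => k /=; rewrite big_bool.
by rewrite le_eqVlt; apply/orP; left; apply/eqP; ring.
Qed.

(** Think of [g i y t] as the probability of predicting [y] at point [i] from sample [t]. For fixed
    [i], each [s] is paired with its flip at [i], and Le Cam's bound with unit weights applies to
    the pair. *)
Lemma average_hard_family_error T (pt : 'I_n.+1 * bool -> T) l
    (g : 'I_n -> bool -> l.-tuple T -> R) :
  (forall i y t, 0 <= g i y t) -> (forall i t, g i true t + g i false t = 1) ->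
  #|{ffun 'I_n -> bool}|%:R * binom_mean (p / n%:R) l (bayes ^~ b) <=
  \sum_s n%:R^-1 * \sum_i iid_mean pt (hard_pmf s) (g i (~~ s i)).
Proof.
move=> g_ge0 g1; rewrite -mulr_sumr exchange_big /= ler_pdivlMl ?ltr0n//.
set N := #|_|%:R; set m := binom_mean _ _ _.
have -> : n%:R * (N * m) = \sum_(i < n) (N * m).
  by rewrite sumr_const card_ord mulr_natl.
apply: ler_sum => i _.
pose flip s : {ffun 'I_n -> bool} := [ffun j => if j == i then ~~ s j else s j].
have flipK : involutive flip.
  by move=> s; apply/ffunP => j; rewrite !ffunE; case: (j == i); rewrite ?negbK.
pose F s := iid_mean pt (hard_pmf s) (g i (~~ s i)).
have F_flip s : 2 * m <= F s + F (flip s).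
  wlog si : s / s i => [hw|].
    have [/hw//|/negbTE si] := boolP (s i).
    by rewrite addrC -{2}(flipK s); apply: hw; rewrite ffunE eqxx si.
  rewrite -binom_meanZ (_ : _ \*o _ = fun k => testing_risk b k 1 1).
    rewrite -[F s]mul1r -[F (flip s)]mul1r /F ffunE eqxx si /=.
    apply: (@le_cam_hard_family _ _ _ _ i) => //; first by rewrite ffunE eqxx si.
    - by move=> j /negbTE ji; rewrite ffunE ji.
    - by move=> t; rewrite addrC g1.
  by apply/funext => k /=; rewrite testing_risk_bayes.
(* Flipping is a bijection, so the sum over pairs counts every [F s] twice. *)
have : \sum_(s : {ffun 'I_n -> bool}) (2 * m) <= \sum_s (F s + F (flip s)).
  exact: ler_sum.
rewrite big_split /= [X in _ + X](_ : _ = \sum_s F s); last first.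
  by rewrite [RHS](reindex_inj (inv_inj flipK)).
rewrite sumr_const -[leLHS]mulr_natl -/N mulrCA -/F -[leRHS]mulr2n -[leRHS]mulr_natl.
by rewrite ler_pM2l.
Qed.

(* With probability (1 - p)^l only point 0 is sampled, which reveals nothing
   about s. *)
Lemma average_hard_family_all_wrong T (pt : 'I_n.+1 * bool -> T) l
    (G : {ffun 'I_n -> bool} -> l.-tuple T -> R) :
  (forall s t, 0 <= G s t) -> (forall t, \sum_s G s t = 1) ->
  (1 - p) ^+ l <= \sum_s iid_mean pt (hard_pmf s) (G s).
Proof.
move=> G_ge0 G1; rewrite -[leLHS]mulr1.
rewrite -[X in _ * X <= _](G1 [tuple of nseq l (pt (ord0, true))]).
rewrite mulr_sumr; apply: ler_sum => s _.
have <- : hard_pmf s (ord0, true) = 1 - p by rewrite /hard_pmf /= unlift_none mulr1.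
by apply: iid_mean_ge_nseq => //; exact: hard_pmf_ge0.
Qed.

End hard_family.

(** * Finitely supported distributions and their samples *)

Section finitely_supported.
Context {R : realType} {disp : measure_display} {T : measurableType disp}.
Context {J : finType}.
Implicit Types (w : J -> R) (pt : J -> T).

Lemma finitely_supported_measure w pt (s : seq J) : (forall z, 0 <= w z) ->
  exists mu : {measure set T -> \bar R},
    (forall A, mu A = (\sum_(z <- s) (w z)%:E * \d_(pt z) A)%E) /\
    (forall f : T -> \bar R, measurable_fun [set: T] f -> (forall x, (0 <= f x)%E) ->
      (\int[mu]_x f x = \sum_(z <- s) (w z)%:E * f (pt z))%E).
Proof.
move=> w0; elim: s => [|z s [mu [muE muI]]].
  exists mzero; split=> [A|f mf f0]; rewrite big_nil//.
  by rewrite integral_measure_zero.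
exists (measure_add (mscale (NngNum (w0 z)) \d_(pt z)) mu); split=> [A|f mf f0].
  by rewrite [LHS]measure_addE big_cons muE.
rewrite ge0_integral_measure_add// ge0_integral_mscale// integral_dirac//.
by rewrite diracT mul1e big_cons muI.
Qed.

Lemma finitely_supported_probability w pt : (forall z, 0 <= w z) ->
  \sum_z w z = 1 ->
  exists P : probability T R,
    (forall A, P A = (\sum_z (w z)%:E * \d_(pt z) A)%E) /\
    (forall f : T -> \bar R, measurable_fun [set: T] f -> (forall x, (0 <= f x)%E) ->
      (\int[P]_x f x = \sum_z (w z)%:E * f (pt z))%E).
Proof.
move=> w0 w1; have [mu [muE muI]] := finitely_supported_measure pt (index_enum J) w0.
have mu1 : mu setT = 1%E.
  by rewrite muE; under eq_bigr do rewrite diracT mule1; rewrite sumEFin w1.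
(* Total mass 1 makes [J] nonempty; [z0] provides the fallback of [mnormalize], which leaves [mu]
   unchanged. *)
have [z0 _|J0] := pickP (@predT J); last first.
  by move/esym/eqP: w1; rewrite big_pred0 ?oner_eq0// => z; have := J0 z.
have PE A : mnormalize mu \d_(pt z0) A = mu A.
  by rewrite /mnormalize mu1 eqe oner_eq0 /= invr1 mule1.
exists (mnormalize mu \d_(pt z0)); split=> [A|f mf f0].
  exact: etrans (PE A) (muE A).
rewrite -muI//; apply: eq_measure_integral => A _ _; exact: PE.
Qed.

(** Tonelli peels off the first observation, turning integrals over samples into the finite sums
    above. *)
Lemma integral_iid w pt (P : probability T R) l (g : l.-tuple T -> R) :
  (forall f : T -> \bar R, measurable_fun [set: T] f -> (forall x, (0 <= f x)%E) ->
    (\int[P]_x f x = \sum_z (w z)%:E * f (pt z))%E) ->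
  measurable_fun setT g -> (forall t, 0 <= g t) ->
  (\int[iid P l]_t (g t)%:E = (iid_mean pt w g)%:E)%E.
Proof.
move=> PI; elim: l g => [|l IH] g mg g0 /=.
  rewrite integral_dirac//; last exact/measurable_EFinP.
  by rewrite diracT mul1e.
have mf : measurable_fun setT (EFin \o g) by exact/measurable_EFinP.
have f0 t : (0 <= (EFin \o g) t)%E by rewrite lee_fin g0.
have mcons : measurable_fun [set: T * l.-tuple T]
    (fun z => [the l.+1.-tuple T of z.1 :: z.2]).
  exact: measurable_cons.
rewrite ge0_integral_distribution// fubini_tonelli1//; last 2 first.
- exact: measurableT_comp mf mcons.
- by move=> x; exact: f0.
rewrite PI.
- rewrite -sumEFin; apply: eq_bigr => z _; rewrite EFinM; congr (_ * _)%E.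
  rewrite /fubini_F /= IH//.
  have mconsz : measurable_fun [set: l.-tuple T]
      (fun t => [the l.+1.-tuple T of pt z :: t]) by exact: measurable_cons.
  exact: measurableT_comp mg mconsz.
- apply: measurable_fun_fubini_tonelli_F => //.
  - exact: measurableT_comp mf mcons.
  - by move=> x; exact: f0.
- by move=> x; apply: integral_ge0 => y _; exact: f0.
Qed.

(** The seed is integrated out first, leaving a function of the sample alone. *)
Lemma product_iid_finite w pt (P : probability T R) l disp' (S : measurableType disp')
    (Q : probability S R) (W : set (l.-tuple T * S)) :
  (forall f : T -> \bar R, measurable_fun [set: T] f -> (forall x, (0 <= f x)%E) ->
    (\int[P]_x f x = \sum_z (w z)%:E * f (pt z))%E) ->
  measurable W ->
  ((iid P l \x Q) W = (iid_mean pt w (fun t => fine (Q (xsection W t))))%:E)%E.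
Proof.
move=> PI mW.
have fineQ t : (fine (Q (xsection W t)))%:E = Q (xsection W t).
  by rewrite fineK// fin_num_measure//; exact: measurable_xsection.
rewrite -(integral_iid (P := P))//.
- by apply: eq_integral => t _; rewrite fineQ.
- by apply: measurableT_comp => //; exact: measurable_fun_xsection.
- by move=> t; rewrite fine_ge0.
Qed.

End finitely_supported.

(** * Reverse Markov inequality and averaging *)

Lemma reverse_markov {R : realType} {disp : measure_display} {T : measurableType disp}
    (Q : probability T R) (Z : T -> R) (u : R) :
  measurable_fun setT Z -> (forall x, 0 <= Z x <= 1) -> 0 <= u -> u < 1 ->
  (\int[Q]_x (Z x)%:E <= u%:E + (1 - u)%:E * Q [set x | (Z x > u)%R])%E.
Proof.
move=> mZ Z01 u0 u1; set B := [set x | _].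
have mB : measurable B.
  rewrite (_ : B = Z @^-1` `]u, +oo[).
    by rewrite -[X in measurable X]setTI; exact: mZ.
  by apply/seteqP; split => x /=; rewrite in_itv/= andbT.
(* Pointwise, Z is at most u off [B] and at most 1 = u + (1 - u) on [B]. *)
apply: (@le_trans _ _ (\int[Q]_x (cst u%:E x + (1 - u)%:E * (\1_B x)%:E)))%E.
  apply: ge0_le_integral => //.
  - by move=> x _; rewrite lee_fin; case/andP: (Z01 x).
  - exact/measurable_EFinP.
  - apply: emeasurable_funD; first exact: measurable_cst.
    by apply: measurable_funeM; apply/measurable_EFinP; exact: measurable_indic.
  - move=> x _; rewrite /= -EFinM -EFinD lee_fin indicE.
    have /andP[_ ?] := Z01 x; have [xB|] := boolP (x \in B).
      by rewrite mulr1 subrKC.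
    by rewrite notin_setE /B /= => /negP; rewrite -leNgt mulr0 addr0.
rewrite ge0_integralD//; last 2 first.
- by move=> x _; rewrite -EFinM lee_fin mulr_ge0// subr_ge0 ltW.
- by apply: measurable_funeM; apply/measurable_EFinP; exact: measurable_indic.
rewrite integral_cst// [X in (u%:E * X)%E](probability_setT Q) mule1 ge0_integralZl_EFin//.
- by rewrite integral_indic// setIT.
- by apply/measurable_EFinP; exact: measurable_indic.
- by rewrite subr_ge0 ltW.
Qed.

Lemma exists_ge_average {R : realType} (I : finType) (F : I -> R) (m : R) :
  (0 < #|I|)%N -> #|I|%:R * m <= \sum_i F i -> exists i, m <= F i.
Proof.
move=> I0 mF; apply: contrapT => /forallNP Fm; move: mF; apply/negP; rewrite -ltNge.
rewrite mulr_natl -sumr_const; apply: ltr_sum => [|i _].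
  by case/card_gt0P: I0 => i _; apply/hasP; exists i; rewrite ?mem_index_enum.
by rewrite ltNge; exact/negP.
Qed.

(** * Lower bounds for a given learner *)

Section lower_bound.
Context {R : realType} {dX : measure_display} {X : measurableType dX}.
Context {H : set (X -> bool)} {n : nat} (x : 'I_n.+1 -> X) (b p eta : R).
Hypothesis n_gt0 : (0 < n)%N.
Hypotheses (b_gt0 : 0 < b) (b_lt1 : b < 1) (p_gt0 : 0 < p) (p_lt1 : p < 1).
Hypothesis bp_eta : p * (2^-1 - b / 2) <= eta.
Hypothesis shattered :
  forall tau : 'I_n.+1 -> bool, exists2 h, H h & forall j, h (x j) = tau j.
Implicit Types (s : {ffun 'I_n -> bool}) (h : X -> bool).

Let pt (z : 'I_n.+1 * bool) : X * bool := (x z.1, z.2).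

Definition wrong_fraction s h : R :=
  n%:R^-1 * \sum_(i < n) (h (x (lift ord0 i)) != s i)%:R.

Definition is_hard_distribution s (D : probability (X * bool)%type R) :=
  (forall A, D A = (\sum_z (hard_pmf b p s z)%:E * \d_(pt z) A)%E) /\
  (forall f : X * bool -> \bar R, measurable_fun setT f ->
    (forall z, (0 <= f z)%E) ->
    (\int[D]_z f z = \sum_z (hard_pmf b p s z)%:E * f (pt z))%E).

Lemma hard_distribution_exists s : exists D, is_hard_distribution s D.
Proof.
apply: finitely_supported_probability; first exact: hard_pmf_ge0.
exact: sum_hard_pmf.
Qed.

Lemma wrong_fraction_ge0 s h : 0 <= wrong_fraction s h.
Proof. by rewrite mulr_ge0// sumr_ge0. Qed.

Lemma wrong_fraction_le1 s h : wrong_fraction s h <= 1.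
Proof.
rewrite ler_pdivrMl ?ltr0n// mulr1 -[leRHS](_ : \sum_(i < n) 1 = _).
  by rewrite ler_sum// => i _; case: (_ != _).
by rewrite sumr_const card_ord.
Qed.

(** Label noise costs (1 - b) / 2 at each of the n points even with the right sign; a wrong sign
    raises this to (1 + b) / 2. *)
Lemma err_hard_distribution s D h : is_hard_distribution s D ->
  err h D = (1 - p) * (~~ h (x ord0))%:R + p * (2^-1 - b / 2)
            + b * p * wrong_fraction s h.
Proof.
move=> [DE _]; rewrite /err DE.
under eq_bigr do rewrite diracE -EFinM.
rewrite sumEFin /=.
rewrite (eq_bigr (fun z => hard_pmf b p s z * (h (x z.1) != z.2)%:R)); last first.
  by move=> z _; congr (_ * (nat_of_bool _)%:R); apply/idP/idP => [/set_mem|/mem_set].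
rewrite (sum_hard_pmf_mul b p s (fun j y => (h (x j) != y)%:R)) eqb_id -addrA.
congr (_ + _); rewrite /wrong_fraction.
rewrite (eq_bigr (fun i => (2^-1 - b / 2) + b * (h (x (lift ord0 i)) != s i)%:R)); last first.
  move=> i _; rewrite big_bool /biased_pmf.
  by case: (s i); case: (h _) => /=; lra.
rewrite big_split /= sumr_const card_ord -mulr_sumr -mulr_natl.
by field; rewrite pnatr_eq0 -lt0n.
Qed.

(** Shattering provides a hypothesis that agrees with [s] and labels point 0 correctly, so only the
    noise remains. *)
Lemma min_err_hard_distribution s D : is_hard_distribution s D ->
  min_err H D <= p * (2^-1 - b / 2).
Proof.
move=> hD; have [h Hh hx] := shattered
  (fun j => if unlift ord0 j is Some i then s i else true).
have -> : p * (2^-1 - b / 2) = err h D.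
  rewrite (err_hard_distribution h hD) hx unlift_none /= mulr0 add0r.
  rewrite /wrong_fraction big1 ?mulr0 ?addr0// => i _.
  by rewrite hx liftK eqxx.
apply: ge_inf; last by exists h.
by exists 0 => _ [g _ <-]; rewrite fine_ge0.
Qed.

Lemma excess_hard_distribution s D h : is_hard_distribution s D ->
  b * p * wrong_fraction s h <= excess H h D.
Proof.
move=> hD; have := min_err_hard_distribution hD.
rewrite /excess (err_hard_distribution h hD).
have : 0 <= (1 - p) * (~~ h (x ord0))%:R by rewrite mulr_ge0// subr_ge0 ltW.
by lra.
Qed.

Lemma hard_distribution_agnostic s D : is_hard_distribution s D ->
  agnostic_class H eta D.
Proof. by move=> /min_err_hard_distribution/le_trans; exact. Qed.

Section fixed_learner.
Context {l : nat} (A : learner R H l).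

(** A learner comes with measurable risks. Its risk against the point mass at [(y, true)] is the
    indicator of predicting [false] at [y]. *)
Lemma measurable_prediction (y : X) c : measurable [set z | A z y = c].
Proof.
pose D : probability (X * bool)%type R := \d_(y, true).
have errE z : err (A z) D = (A z y != true)%:R.
  rewrite /err [X in fine X]diracE /=; congr ((nat_of_bool _)%:R).
  by apply/idP/idP => [/set_mem|/mem_set].
have mtrue : measurable [set z | A z y = true].
  rewrite (_ : [set _ | _] = (fun z => err (A z) D) @^-1` [set 0]).
    by rewrite -[X in measurable X]setTI; exact: (@measurable_output _ _ _ _ _ A D).
  by apply/seteqP; split => z /=; rewrite errE; case: (A z y) => //= /eqP; rewrite oner_eq0.
case: c => //; rewrite (_ : [set _ | _] = ~` [set z | A z y = true]).
  exact: measurableC.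
by apply/seteqP; split => z /=; case: (A z y).
Qed.

(** Given the sample [t], [g i c t] and [G s t] are the probabilities over the seed of predicting
    [c] at point [i], and of getting every sign of [s] wrong. *)
Let W (i : 'I_n) c := [set z | A z (x (lift ord0 i)) = c].
Let g i c t := fine (seed_prob A (xsection (W i c) t)).
Let allW s := [set z | forall i, A z (x (lift ord0 i)) = ~~ s i].
Let G s t := fine (seed_prob A (xsection (allW s) t)).

Let mW i c : measurable (W i c). Proof. exact: measurable_prediction. Qed.

Let mallW s : measurable (allW s).
Proof.
rewrite (_ : allW s = \bigcap_(i : 'I_n) W i (~~ s i)).
  by apply: fin_bigcap_measurable.
by apply/seteqP; split=> [z h i _|z h i]; [exact: h|exact: (h i)].
Qed.

Let g_ge0 i c t : 0 <= g i c t. Proof. exact: fine_ge0. Qed.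
Let G_ge0 s t : 0 <= G s t. Proof. exact: fine_ge0. Qed.

Let g_sum1 i t : g i true t + g i false t = 1.
Proof.
have mx := measurable_xsection t (mW i true).
have -> : g i false t = fine (seed_prob A (~` xsection (W i true) t)).
  congr (fine (_ _)); apply/seteqP; split => w; rewrite /xsection /W /= !inE /=.
    by move=> ->.
  by case: (A _ _).
rewrite probability_setC// fineB ?fin_num_measure//= /g.
by rewrite addrC subrK.
Qed.

(** The events [allW s] partition the space: a prediction vector is entirely wrong for exactly one
    [s], its negation. *)
Let G_sum1 t : \sum_s G s t = 1.
Proof.
apply: EFin_inj; rewrite -sumEFin.
have mx s := measurable_xsection t (mallW s).
transitivity (\sum_s \int[seed_prob A]_w (\1_(xsection (allW s) t) w)%:E)%E.
  by apply: eq_bigr => s _; rewrite integral_indic// setIT fineK// fin_num_measure.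
rewrite -ge0_integral_sum//; last first.
  by move=> s; apply/measurable_EFinP; exact: measurable_indic.
transitivity (\int[seed_prob A]_w cst 1%E w)%E; last first.
  by rewrite integral_cst// mul1e; exact: probability_setT.
apply: eq_integral => w _; rewrite sumEFin; congr EFin.
pose s0 : {ffun 'I_n -> bool} := [ffun i => ~~ A (t, w) (x (lift ord0 i))].
rewrite (bigD1 s0)//= big1 => [|s ss0]; rewrite indicE.
  rewrite mem_set ?addr0// /xsection /= mem_set// => i /=.
  by rewrite ffunE negbK.
rewrite memNset// /xsection /= => /set_mem h; move/eqP: ss0; apply.
by apply/ffunP => i; rewrite ffunE h negbK.
Qed.

Let mean_wrong s : R := n%:R^-1 * \sum_i iid_mean pt (hard_pmf b p s) (g i (~~ s i)).

Let measurable_wrong_fraction s : measurable_fun setT (fun z => wrong_fraction s (A z)).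
Proof.
apply: measurable_funM => //; apply: measurable_sum => i.
rewrite (_ : (fun _ => _) = \1_(W i (~~ s i))); first exact: measurable_indic.
apply/funext => z; rewrite indicE /W; congr ((nat_of_bool _)%:R); apply/idP/idP.
  by move=> h; rewrite inE /=; move: h; case: (A _ _); case: (s i).
by rewrite inE /= => ->; case: (s i).
Qed.

Let integral_wrong_fraction s D : is_hard_distribution s D ->
  (\int[run_law A D]_z (wrong_fraction s (A z))%:E = (mean_wrong s)%:E)%E.
Proof.
move=> [_ DI].
transitivity (\int[run_law A D]_z ((n%:R^-1)%:E * \sum_(i < n) (\1_(W i (~~ s i)) z)%:E))%E.
  apply: eq_integral => z _; rewrite /wrong_fraction EFinM -sumEFin.
  congr (_ * _)%E; apply: eq_bigr => i _; congr EFin.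
  rewrite indicE /W; congr ((nat_of_bool _)%:R); apply/idP/idP.
    by move=> h; rewrite inE /=; move: h; case: (A _ _); case: (s i).
  by rewrite inE /= => ->; case: (s i).
have mI i : measurable_fun setT (fun z => (\1_(W i (~~ s i)) z)%:E : \bar R).
  by apply/measurable_EFinP; exact: measurable_indic.
rewrite ge0_integralZl_EFin//; last 2 first.
- by move=> z _; apply: sume_ge0.
- exact: emeasurable_sum.
rewrite ge0_integral_sum// /mean_wrong EFinM -sumEFin; congr (_ * _)%E.
apply: eq_bigr => i _; rewrite integral_indic// setIT.
exact: (product_iid_finite _ DI).
Qed.

Let measurable_excess (D : probability (X * bool)%type R) :
  measurable_fun setT (fun z => excess H (A z) D).
Proof. by apply: measurable_funB => //; exact: measurable_output. Qed.

Lemma exists_expected_excess_ge :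
  exists2 D : probability (X * bool)%type R, agnostic_class H eta D &
    ((b * p * binom_mean (p / n%:R) l (bayes ^~ b))%:E <= expected_excess A D)%E.
Proof.
have [|s ms] := @exists_ge_average _ _ mean_wrong (binom_mean (p / n%:R) l (bayes ^~ b)) _
  (average_hard_family_error b_gt0 b_lt1 p_gt0 p_lt1 n_gt0 pt g_ge0 g_sum1).
  by rewrite card_ffun expn_gt0 card_bool.
have [D hD] := hard_distribution_exists s.
exists D; first exact: hard_distribution_agnostic hD.
have bp0 : 0 <= b * p by rewrite mulr_ge0 ?ltW.
apply: (@le_trans _ _ ((b * p)%:E * (mean_wrong s)%:E)%E).
  by rewrite -EFinM lee_fin ler_wpM2l.
rewrite -(integral_wrong_fraction hD) -ge0_integralZl_EFin//; last 2 first.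
- by move=> z _; rewrite lee_fin wrong_fraction_ge0.
- exact/measurable_EFinP.
rewrite /expected_excess unlock; apply: ge0_le_integral => //.
- by move=> z _; rewrite -EFinM lee_fin mulr_ge0 ?wrong_fraction_ge0.
- by apply: measurable_funeM; exact/measurable_EFinP.
- exact/measurable_EFinP.
- by move=> z _; rewrite -EFinM lee_fin excess_hard_distribution.
Qed.

(** Reverse Markov rearranges to P(Z > u) >= E Z - u + u P(Z > u), and the last probability is at
    least that of all signs being wrong. *)
Lemma exists_excess_tail_ge u : 0 <= u -> u < 1 ->
  exists2 D : probability (X * bool)%type R, agnostic_class H eta D &
    ((binom_mean (p / n%:R) l (bayes ^~ b) - u
      + u * ((1 - p) ^+ l / #|{ffun 'I_n -> bool}|%:R))%:E
     <= excess_tail A (b * p * u) D)%E.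
Proof.
move=> u0 u1; set m := binom_mean _ _ _; set N := #|_|%:R.
have cardN : (0 < #|{ffun 'I_n -> bool}|)%N by rewrite card_ffun expn_gt0 card_bool.
have N0 : 0 < N by rewrite ltr0n.
(* One [s] must serve both terms, so their combination is averaged at once. *)
pose F s := mean_wrong s - u + u * iid_mean pt (hard_pmf b p s) (G s).
have [//||s ms] := @exists_ge_average _ _ F (m - u + u * ((1 - p) ^+ l / N)).
  rewrite /F !big_split /= sumr_const -[(- u) *+ _]mulr_natl -/N.
  rewrite 2!mulrDr; apply: lerD; first apply: lerD => //.
    exact: (average_hard_family_error b_gt0 b_lt1 p_gt0 p_lt1 n_gt0 pt g_ge0 g_sum1).
  rewrite (_ : N * _ = u * (1 - p) ^+ l); last by field; rewrite gt_eqF.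
  by rewrite -mulr_sumr ler_wpM2l//;
    exact: (average_hard_family_all_wrong b_gt0 b_lt1 p_gt0 p_lt1 pt G_ge0 G_sum1).
have [D hD] := hard_distribution_exists s.
exists D; first exact: hard_distribution_agnostic hD.
set B := [set z | wrong_fraction s (A z) > u].
have mB : measurable B.
  rewrite (_ : B = (fun z => wrong_fraction s (A z)) @^-1` `]u, +oo[).
    by rewrite -[X in measurable X]setTI; exact: measurable_wrong_fraction.
  by apply/seteqP; split => z /=; rewrite in_itv/= andbT.
apply: (@le_trans _ _ (run_law A D B)); last first.
  apply: le_measure; rewrite ?inE//.
    rewrite (_ : [set _ | _] = (fun z => excess H (A z) D) @^-1` `]b * p * u, +oo[).
      by rewrite -[X in measurable X]setTI; exact: measurable_excess.
    by apply/seteqP; split => z /=; rewrite in_itv/= andbT.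
  move=> z /=; rewrite /B /= => uz; apply: lt_le_trans (excess_hard_distribution _ hD).
  by rewrite ltr_pM2l// mulr_gt0.
have Bfin : run_law A D B \is a fin_num by exact: fin_num_measure.
have Z01 z : 0 <= wrong_fraction s (A z) <= 1.
  by rewrite wrong_fraction_ge0 wrong_fraction_le1.
have := reverse_markov (run_law A D) (measurable_wrong_fraction s) Z01 u0 u1.
rewrite (integral_wrong_fraction hD) -/B.
have : (run_law A D (allW s) <= run_law A D B)%E.
  apply: le_measure; rewrite ?inE// => z; rewrite /B /allW /= => h.
  apply: lt_le_trans u1 _; rewrite /wrong_fraction ler_pdivlMl ?ltr0n// mulr1.
  rewrite (eq_bigr (fun=> 1)); first by rewrite sumr_const card_ord.
  by move=> i _; rewrite h; case: (s i).
have -> : run_law A D (allW s) = (iid_mean pt (hard_pmf b p s) (G s))%:E.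
  exact: (product_iid_finite _ hD.2).
rewrite -(fineK Bfin) -EFinM -EFinD !lee_fin => h1 h2.
apply: le_trans ms _; rewrite /F.
have := ler_wpM2l u0 h1; lra.
Qed.

End fixed_learner.
End lower_bound.

(** * From a shattered set to the minimax bounds *)

Lemma shatters_labelling {X : Type} (H : set (X -> bool)) (d : nat) (A : set X) :
  (A #= `I_d)%card -> shatters H A ->
  exists x : 'I_d -> X,
    forall tau : 'I_d -> bool, exists2 h, H h & forall j, h (x j) = tau j.
Proof.
move=> /card_set_bijP[f [_ _ fsurj]] shA.
have /choice[x xP] : forall j : 'I_d, exists a, A a /\ f a = j.
  by move=> j; have [a Aa fa] := fsurj _ (ltn_ord j); exists a.
exists x => tau.
have [_ [j _ <-]|h Hh hE] := shA [set x j | j in [set j | tau j]].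
  exact: (xP j).1.
exists h => // j.
have [tj|ntj] := boolP (tau j).
  by have [] : (A `&` [set a | h a = true]) (x j) by rewrite hE; exists j.
apply/negbTE/negP => hj; have : (A `&` [set a | h a = true]) (x j).
  by split=> //; exact: (xP j).1.
(* Since [f] recovers the index from the point, distinct indices give distinct points. *)
rewrite hE => -[k /= tk] /(congr1 f); rewrite !(xP _).2 => /val_inj kj.
by rewrite -kj tk in ntj.
Qed.

Lemma exists_bias {R : realType} (l : nat) (v : R) : 0 <= v -> v < 2^-1 ->
  exists2 b, 0 < b < 1 & v < (1 - b) ^+ l / 2.
Proof.
(* With this [b], l b < 1/2 - v, so Bernoulli's inequality gives (1 - b)^l >= 1 - l b > 2 v; [l.+1]
   avoids dividing by zero. *)
move=> v0 v1; pose b : R := (2^-1 - v) / l.+1%:R.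
have l0 : 0 < l.+1%:R :> R by rewrite ltr0n.
have b0 : 0 < b by rewrite divr_gt0// subr_gt0.
have bl : b * l.+1%:R = 2^-1 - v by rewrite divfK// gt_eqF.
have b1 : b < 1.
  rewrite -(ltr_pM2r l0) bl mul1r; apply: (@lt_le_trans _ _ 1); first lra.
  by rewrite ler1n.
exists b; first by rewrite b0.
have bern k : 1 - k%:R * b <= (1 - b) ^+ k.
  elim: k => [|k IH]; first by rewrite mul0r subr0.
  rewrite exprS -natr1; have k0 : 0 <= k%:R :> R by [].
  by set e := _ ^+ k in IH *; set c : R := k%:R in IH k0 *; nra.
have := bern l; rewrite -natr1 in bl; lra.
Qed.

Unset Implicit Arguments.

Theorem theorem18 (R : realType) (dX : measure_display) (X : measurableType dX)
    (H : set (X -> bool)) (d l : nat) (eta : R)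
    (mH : forall h, H h -> measurable_fun [set: X] h)
    (dH : VC_dim H d) (d_gt1 : (1 < d)%N) (l_ge1 : (1 <= l)%N)
    (eta_gt0 : 0 < eta) (eta_lt12 : eta < 2^-1)
    (b p : R) (b_gt0 : 0 < b) (b_lt1 : b < 1) (p_gt0 : 0 < p) (p_lt1 : p < 1)
    (bp_eta : p * (2^-1 - b / 2) <= eta) :
  ((b * p * bayes_check (l%:R * p / (d%:R - 1)) b)%:E
     <= minimax_expected H l eta)%E
  /\
  (forall u : R, 0 <= u -> u < 1 ->
    ((bayes_check (l%:R * p / (d%:R - 1)) b - u)%:E
       < minimax_tail H l eta (b * p * u))%E).
Proof.
have [A [A_d shA]] := dH.1.
case: d d_gt1 {dH} A_d => // n; rewrite ltnS => n_gt0 A_d.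
have [x shattered] := shatters_labelling A_d shA.
have nE : n.+1%:R - 1 = n%:R :> R by rewrite -natr1 addrK.
have n0 : 0 < n%:R :> R by rewrite ltr0n.
have x0 : 0 < l%:R * p / n%:R by rewrite divr_gt0// mulr_gt0// ltr0n.
have b1 : -1 <= b <= 1 by apply/andP; split; lra.
have q01 : 0 <= p / n%:R <= 1 by rewrite divr_nat_itv01// !ltW.
rewrite nE; set v := bayes_check _ b.
have v_le : v <= binom_mean (p / n%:R) l (bayes ^~ b).
  by rewrite /v -mulrA bayes_check_le_binom_mean.
split=> [|u u0 u1].
  apply: le_ereal_inf_tmp => _ [L ->].
  have [D hD vD] := exists_expected_excess_ge n_gt0 b_gt0 b_lt1 p_gt0 p_lt1
    bp_eta shattered L.
  apply: (@le_trans _ _ (expected_excess L D)); last by apply: ereal_sup_ubound; exists D.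
  by apply: le_trans vD; rewrite lee_fin ler_wpM2l// mulr_ge0 ?ltW.
(* Stated for any admissible bias and mass, because the case u = 0 uses a pair other than [b],
   [p]. *)
have tail_ge b' p' (b'_gt0 : 0 < b') (b'_lt1 : b' < 1) (p'_gt0 : 0 < p') (p'_lt1 : p' < 1) :
    p' * (2^-1 - b' / 2) <= eta ->
    ((binom_mean (p' / n%:R) l (bayes ^~ b') - u
      + u * ((1 - p') ^+ l / #|{ffun 'I_n -> bool}|%:R))%:E
     <= minimax_tail H l eta (b' * p' * u))%E.
  move=> b'p'_eta; apply: le_ereal_inf_tmp => _ [L ->].
  have [D hD vD] := exists_excess_tail_ge n_gt0 b'_gt0 b'_lt1 p'_gt0 p'_lt1
    b'p'_eta shattered L u0 u1.
  by apply: le_trans vD _; apply: ereal_sup_ubound; exists D.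
have [u_gt0|u_le0] := ltP 0 u.
  apply: lt_le_trans (tail_ge _ _ b_gt0 b_lt1 p_gt0 p_lt1 bp_eta).
  have : 0 < u * ((1 - p) ^+ l / #|{ffun 'I_n -> bool}|%:R).
    rewrite mulr_gt0// divr_gt0 ?exprn_gt0 ?subr_gt0//.
    by rewrite ltr0n card_ffun expn_gt0 card_bool.
  by rewrite lte_fin; lra.
have u_eq0 : u = 0 by apply/le_anti; rewrite u_le0.
have v_ge0 : 0 <= v by rewrite bayes_check_ge0// ltW.
have v_lt : v < 2^-1 by rewrite bayes_check_lt_half// b_gt0 ltW.
have [b' /andP[b'_gt0 b'_lt1] vb'] := exists_bias l v_ge0 v_lt.
(* At threshold 0 the masses do not matter, so the bias may be taken as small
   as desired: this is what makes the bound strict. *)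
have p'_eta : 2 * eta * (2^-1 - b' / 2) <= eta by nra.
have p'_gt0 : 0 < 2 * eta by lra.
have p'_lt1 : 2 * eta < 1 by lra.
have := tail_ge _ _ b'_gt0 b'_lt1 p'_gt0 p'_lt1 p'_eta.
rewrite u_eq0 !mulr0 mul0r addr0 !subr0; apply: lt_le_trans.
rewrite lte_fin; apply: lt_le_trans vb' _.
(* At most l observations fall on a point, so every Bayes risk in the average is at least (1 - b')^l
   / 2. *)
rewrite -[leLHS](binom_mean_cst (2 * eta / n%:R) l); apply: binom_mean_le.
  by rewrite divr_nat_itv01// !ltW.
move=> k kl; have b'01 : 0 <= b' <= 1 by rewrite !ltW.
apply: le_trans (bayes_ge_expr k b'01); rewrite ler_pM2r ?invr_gt0//.
by apply: ler_wiXn2l => //; lra.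
Qed.
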